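(* Let $\mathbb{Z}^2$ be equipped with the connection $\mathcal{C}$ induced by a neighbor relation $r$ as in the context, and let $f\in\mathcal{A}(\mathbb{Z}^2)$. a) For every $n\in\mathbb{N}$ the function $((id-U_n\circ L_n)\circ F_{n-1})(f)$ is a sum of discrete pulses with disjoint support, that is, there exist $\gamma(n)\in\mathbb{N}$ and pulses $\phi_{ns}$, $s=1,\dots,\gamma(n)$, such that $$((id-U_n\circ L_n)\circ F_{n-1})(f)=\sum_{s=1}^{\gamma(n)}\phi_{ns}$$ and $$\mathrm{supp}(\phi_{ns_1})\cap\mathrm{supp}(\phi_{ns_2})=\emptyset\quad\text{for } s_1\ne s_2.$$ b) Let $n_1,n_2,s_1,s_2\in\mathbb{N}$ be such that $n_1<n_2$, $1\le s_1\le\gamma(n_1)$ and $1\le s_2\le\gamma(n_2)$. Then $$\mathrm{supp}(\phi_{n_1s_1})\cap\mathrm{supp}(\phi_{n_2s_2})\ne\emptyset\ \Longrightarrow\ \mathrm{supp}(\phi_{n_1s_1})\subset\mathrm{supp}(\phi_{n_2s_2}).$$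
   Context: $\mathbb{N}=\{1,2,\dots\}$. $\mathcal{A}(\mathbb{Z}^2)$ is the space of all functions $f:\mathbb{Z}^2\to\mathbb{R}$ with pointwise operations; $id$ is the identity operator and $(id-P)(f)=f-P(f)$. Neighbor relation: $r$ is a relation on $\mathbb{Z}^2$ which is reflexive, symmetric and shift invariant, and satisfies $((i,j),(i\pm1,j))\in r$ and $((i,j),(i,j\pm1))\in r$ for all $i,j\in\mathbb{Z}$; $p,q$ are neighbors if $(p,q)\in r$. A set $C\subseteq\mathbb{Z}^2$ is connected if for any two $p,q\in C$ there is a set $\{p_1,\dots,p_k\}\subseteq C$ such that $p$ is a neighbor of $p_1$, each $p_i$ is a neighbor of $p_{i+1}$, and $p_k$ is a neighbor of $q$. $\mathcal{C}$ is the family of all connected sets. For $x\in\mathbb{Z}^2$, $n\in\mathbb{N}$ let $\mathcal{N}_n(x)=\{V\in\mathcal{C}:x\in V,\ \mathrm{card}(V)=n+1\}$ and $$L_n(f)(x)=\max_{V\in\mathcal{N}_n(x)}\min_{y\in V}f(y),\qquad U_n(f)(x)=\min_{V\in\mathcal{N}_n(x)}\max_{y\in V}f(y).$$ Define $F_0=id$, $F_1=U_1\circ L_1$ and $F_n=U_n\circ L_n\circ F_{n-1}$. A (discrete) pulse is a function $\phi\in\mathcal{A}(\mathbb{Z}^2)$ for which there exist a connected set $V$ and a real number $\alpha$ with $\phi(x)=\alpha$ for $x\in V$ and $\phi(x)=0$ for $x\in\mathbb{Z}^2\setminus V$; the set $V$ is called the support of the pulse and is denoted $\mathrm{supp}(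\phi)$.
   Formalization: γ(n) may be infinite, as the finite claim fails for general f (4-neighbors, f(10k,0)=k, else 0); γ(n) is proved finite whenever f or ((id-U_n∘L_n)∘F_{n-1})(f) has finite support. Max and min over N_n(x) are read as sup and inf, since N_n(x) may be infinite. *)

(* Defs.v *)
From mathcomp Require Import all_boot all_order all_algebra.
From mathcomp Require Import all_classical reals.

Set Implicit Arguments.
Unset Strict Implicit.
Unset Printing Implicit Defensive.

Import Order.TTheory GRing.Theory Num.Theory.
Local Open Scope classical_set_scope.
Local Open Scope ring_scope.

Notation Z2 := (int * int)%type.

(* Neighborhoods are not assumed finite. *)
Record neighbor_relation (r : rel Z2) : Prop := NeighborRelation {
  neighbor_refl : reflexive r;
  neighbor_sym : symmetric r;
  neighbor_shift : forall p q a : Z2, r (p + a) (q + a) = r p q;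
  neighbor_horizontal : forall i j : int, r (i, j) (i + 1, j) /\ r (i, j) (i - 1, j);
  neighbor_vertical : forall i j : int, r (i, j) (i, j + 1) /\ r (i, j) (i, j - 1) }.

(* In particular the empty set is connected. *)
Definition connected_set (r : rel Z2) (C : set Z2) : Prop :=
  forall p q, C p -> C q ->
    exists s : seq Z2, [/\ s != [::], [set` s] `<=` C & path r p (rcons s q)].

Definition nbh (r : rel Z2) (n : nat) (x : Z2) : set (set Z2) :=
  [set V | [/\ connected_set r V, V x & (V #= `I_n.+1)%card]].

Section Operators.
Variables (R : realType) (r : rel Z2).
Implicit Types (f : Z2 -> R) (P : (Z2 -> R) -> Z2 -> R).

(* The inner extrema are over finite nonempty sets.  The outer ones are maxima
   and minima as soon as [nbh r n x] is finite; if a point has infinitely many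
   neighbors they need not be attained, but for a neighbor relation the set of
   values is nonempty and bounded by [f x], so [sup] and [inf] never take their
   default value. *)
Definition L (n : nat) f : Z2 -> R :=
  fun x => sup [set inf (f @` V) | V in nbh r n x].

Definition U (n : nat) f : Z2 -> R :=
  fun x => inf [set sup (f @` V) | V in nbh r n x].

Fixpoint F (n : nat) : (Z2 -> R) -> Z2 -> R :=
  if n is n'.+1 then U n'.+1 \o L n'.+1 \o F n' else id.

Definition idB P : (Z2 -> R) -> Z2 -> R := fun f => f \- P f.

(* The support is a datum: it is determined by the function only when the
   height [alpha] is nonzero. *)
Record pulse := Pulse {
  pulse_fun :> Z2 -> R;
  supp : set Z2;
  supp_connected : connected_set r supp;
  pulseP : exists alpha : R,
    (forall x, supp x -> pulse_fun x = alpha) /\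
    (forall x, ~ supp x -> pulse_fun x = 0) }.

End Operators.

Definition nonzero_set (R : realType) (f : Z2 -> R) : set Z2 := [set x | f x != 0].

(* [upto g] is {1, ..., m} if g = Some m, and {1, 2, ...} if g = None; thus
   [option nat] encodes a number of pulses that may be infinite.  An arbitrary f
   may require infinitely many pulses at one level: with the 4-point neighbor
   relation and f (10k, 0) = k for k >= 1, f = 0 elsewhere, one has L_1 f = 0, so
   (id - U_1 o L_1) f = f takes infinitely many values. *)
Definition upto (g : option nat) : set nat :=
  [set s | (1 <= s)%N /\ (if g is Some m then (s <= m)%N else True)].

(* Main.v *)
Require Import Defs.
From mathcomp Require Import finmap.
From mathcomp Require Import all_boot all_order all_algebra zify lra.
From mathcomp Require Import all_classical reals.

(* With n = m + 1, put g = F_m f, h = L_n g and k = U_n h.  Neither g nor -g has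
   a peak on fewer than n points, so wherever h(x) < g(x) the component A of
   {g > h(x)} at x has exactly n points, g is constant on A, and h = h(x) on A;
   no point adjacent to A is changed by L_n.  The same holds for U_n with h < k,
   and the two kinds of sets are disjoint: an A meeting a B would coincide with
   it, while an adjacent point has value at most h(x) and at least k(x) > h(x).
   Hence every component V of a nonzero level set of g - k has exactly n points
   and k is constant on V.  These components are the supports.  As L and U
   preserve constancy on connected sets, later levels are constant on V, so a
   later support that meets V contains V; it is strictly larger since it has
   more points.  Attainment of the extrema over the neighborhoods is never
   needed, as s < L_n(f)(x) always means that some V in N_n(x) has f > s on V. *)

Set Implicit Arguments.
Unset Strict Implicit.
Unset Printing Implicit Defensive.

Import Order.TTheory GRing.Theory Num.Theory.
Local Open Scope classical_set_scope.
Local Open Scope ring_scope.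

(** * Components of subsets of the grid and connected sets of given size *)

Section Components.
Variables (r : rel Z2) (hr : neighbor_relation r).
Implicit Types (S T V W : set Z2) (p q x y z : Z2) (m n : nat).

(* If [S x], this is the component of [S] at [x]. *)
Inductive comp S x : Z2 -> Prop :=
| compxx : comp S x x
| comp_step p q : comp S x p -> r p q -> S q -> comp S x q.
Arguments compxx {S x}.
#[local] Hint Resolve compxx : core.

Lemma comp_sub S x : S x -> comp S x `<=` S.
Proof. by move=> Sx y []. Qed.

Lemma comp_trans S y x z : comp S x y -> comp S y z -> comp S x z.
Proof. by move=> xy; elim=> // p q _ + pq Sq => /comp_step; apply. Qed.

Lemma comp_sym S x y : S x -> comp S x y -> comp S y x.
Proof.
move=> Sx; elim=> [|p q xp IH pq Sq]; first exact: compxx.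
apply: comp_trans IH; apply: (comp_step compxx); last exact: comp_sub xp.
by rewrite (neighbor_sym hr).
Qed.

Lemma comp_mono S T x : S `<=` T -> comp S x `<=` comp T x.
Proof.
by move=> ST y; elim=> [|p q _ + pq /ST Tq]; [exact: compxx|move/comp_step; apply].
Qed.

(** The definition asks for a nonempty chain; reflexivity of [r] provides one by repeating both
    endpoints of a path. *)
Lemma connected_setP V :
  connected_set r V <-> forall x y, V x -> V y -> comp V x y.
Proof.
split=> VC x y Vx Vy; last first.
  have [s [xs sV <-]] : [set y | exists s,
      [/\ path r x s, [set` s] `<=` V & last x s = y]] y.
    elim: {Vy}(VC _ _ Vx Vy); first by exists [::].
    move=> p q _ [s [xs sV sp]] pq Vq; exists (rcons s q).
    rewrite rcons_path last_rcons xs sp; split=> // z /=.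
    by rewrite mem_rcons inE => /orP[/eqP->//|/sV].
  exists (x :: s); split=> //= [z|].
    by rewrite /= inE => /orP[/eqP->//|/sV].
  by rewrite rcons_path xs (neighbor_refl hr) /= (neighbor_refl hr).
have [s [_ sV]] := VC _ _ Vx Vy.
suff: forall p, comp V x p -> path r p (rcons s y) -> comp V x y.
  by apply; exact: compxx.
elim: s sV => [_ p xp /= /andP[pq _]|a s IH sV p xp /= /andP[pa sy]].
  exact: comp_step pq Vy.
apply: IH sy; first by move=> b sb; apply: sV; rewrite /= inE (sb : b \in s) orbT.
by apply: comp_step pa _ => //; apply: sV; rewrite /= mem_head.
Qed.

Lemma connected_comp S x : S x -> connected_set r (comp S x).
Proof.
move=> Sx; apply/connected_setP.
have xy y : comp S x y -> comp (comp S x) x y.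
  elim=> [|p q xp IH pq Sq]; first exact: compxx.
  by apply: (comp_step IH pq); apply: comp_step xp pq Sq.
move=> y z /xy ? /xy ?; apply: (@comp_trans _ x) => //.
exact: comp_sym.
Qed.

Lemma connected_sub_comp S V x :
  connected_set r V -> V `<=` S -> V x -> V `<=` comp S x.
Proof.
by move=> /connected_setP VC VS Vx y Vy; apply: (comp_mono VS); apply: VC.
Qed.

Lemma nbhx n x V : nbh r n x V -> V x. Proof. by case. Qed.

Lemma nbh_connected n x V : nbh r n x V -> connected_set r V.
Proof. by case. Qed.

Lemma nbh_card n x V : nbh r n x V -> (V #= `I_n.+1)%card.
Proof. by case. Qed.

Lemma nbh_mem n x V y : nbh r n x V -> V y -> nbh r n y V.
Proof. by case=> ? ? ? ?; split. Qed.

Lemma nbh_finite n x V : nbh r n x V -> finite_set V.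
Proof. by case=> _ _ Vn; apply/finite_setP; exists n.+1. Qed.

Lemma nbh_eq n x y V W : nbh r n x V -> nbh r n y W -> V `<=` W -> V = W.
Proof.
move=> nV nW VW.
have /finite_fsetP[X VX] := nbh_finite nV.
have /finite_fsetP[Y WY] := nbh_finite nW.
move: (nbh_card nV) (nbh_card nW) VW; rewrite VX WY.
move=> /card_eq_fsetP cX /card_eq_fsetP cY XY.
by have /eqP -> : X == Y by rewrite eqEfcard cX cY leqnn andbT; apply/fsubsetP.
Qed.

Lemma nbh0 x : nbh r 0 x [set x].
Proof.
split=> //; last exact: card_set1.
by apply/connected_setP => p q -> ->; exact: compxx.
Qed.

Lemma nbhS n x V p q :
  nbh r n x V -> V p -> r p q -> ~ V q -> nbh r n.+1 x (V `|` [set q]).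
Proof.
move=> nV Vp pq Vq; split; last 1 first.
- have /finite_fsetP[X VX] := nbh_finite nV.
  move: (nbh_card nV) Vq; rewrite VX => /card_eq_fsetP cX /negP Xq.
  have -> : [set` X] `|` [set q] = [set` (q |` X)%fset].
    apply/seteqP; split=> z /=; rewrite !inE.
      by case=> [->|->]; rewrite ?eqxx ?orbT.
    by case/orP=> [/eqP ->|]; [right|left].
  by apply/card_eq_fsetP; rewrite cardfsU1 Xq cX.
- have qV z : V z -> comp (V `|` [set q]) q z.
    move=> Vz; apply: (@comp_trans _ p).
      by apply: (comp_step compxx); [rewrite (neighbor_sym hr)|left].
    apply: (comp_mono (S := V)); first by move=> ?; left.
    by have /connected_setP := nbh_connected nV; apply.
  apply/connected_setP => y z [Vy|->] [Vz|->]; try exact: qV; last exact: compxx.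
    apply: (comp_mono (S := V)); first by move=> ?; left.
    by have /connected_setP := nbh_connected nV; apply.
  by apply: comp_sym; [right|exact: qV].
- by left; apply: nbhx nV.
Qed.

(** If no one-point extension worked, [V] would be closed under steps inside [S] and so contain the
    whole component. *)
Lemma nbh_grow S V m x y : nbh r m x V -> V `<=` comp S x ->
  comp S x y -> ~ V y -> exists2 W, nbh r m.+1 x W & W `<=` comp S x.
Proof.
move=> nV VS xy Vy; apply: contrapT => noW; apply: Vy.
elim: xy => [|p q _ Vp pq Sq]; first exact: nbhx nV.
 apply: contrapT => Vq; apply: noW.
exists (V `|` [set q]); first exact: nbhS pq Vq.
by move=> z [/VS//|->]; apply: comp_step (VS _ Vp) pq Sq.
Qed.

(** A neighborhood grows from [x] one point at a time: while it is smaller than [Z], some point of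
    [Z] lies outside it. This makes bigness a property of the component rather than of the base
    point. *)
Lemma nbh_comp S n x Z : (Z #= `I_n.+1)%card -> Z `<=` comp S x ->
  exists2 W, nbh r n x W & W `<=` comp S x.
Proof.
move=> Zn Zx.
suff: forall m, (m <= n)%N -> exists2 W, nbh r m x W & W `<=` comp S x by apply.
elim=> [_|m IH mn]; first by exists [set x]; [exact: nbh0|move=> ? ->; exact: compxx].
have [V nV Vx] := IH (ltnW mn).
have [y Zy Vy] : exists2 y, Z y & ~ V y.
  apply: contrapT => noy.
  have /subset_card_le : Z `<=` V.
    by move=> y Zy; apply: contrapT => Vy; apply: noy; exists y.
  rewrite (card_le_eql Zn) (card_le_eqr (nbh_card nV)) card_le_II.
  by rewrite ltnNge mn.
exact: nbh_grow Vx (Zx _ Zy) Vy.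
Qed.

(* Equivalently, [S x] holds and the component of [S] at [x] has at least [n.+1]
   points, infinitely many being allowed. *)
Definition big n S x := exists2 V, nbh r n x V & V `<=` S.

Lemma big_in n S x : big n S x -> S x.
Proof. by case=> V nV; apply; apply: nbhx nV. Qed.

Lemma big_comp n S x y : comp S x y -> S x -> big n S y -> big n S x.
Proof.
move=> xy Sx [V nV VS].
have [|W nW Wx] := @nbh_comp S n x V (nbh_card nV).
  move=> z Vz; apply: comp_trans xy _.
  exact: connected_sub_comp (nbh_connected nV) VS (nbhx nV) _ Vz.
by exists W => // z /Wx; apply: comp_sub.
Qed.

Lemma big_sub n S T x : S `<=` T -> big n S x -> big n T x.
Proof. by move=> ST [V nV VS]; exists V => // z /VS/ST. Qed.

Lemma big_connected n S V x y :
  connected_set r V -> V `<=` S -> V x -> V y -> big n S y -> big n S x.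
Proof.
move=> VC VS Vx Vy; apply: big_comp; last exact: VS.
exact: connected_sub_comp VC VS Vx _ Vy.
Qed.

(** A neighborhood that missed a point of the component could be grown to m + 2 points. *)
Lemma nbh_comp_exact m S x : big m S x -> ~ big m.+1 S x ->
  nbh r m x (comp S x).
Proof.
move=> bm nb; have Sx := big_in bm; case: bm => V nV VS.
have Vx : V `<=` comp S x := connected_sub_comp (nbh_connected nV) VS (nbhx nV).
suff -> : comp S x = V by [].
apply/seteqP; split=> // y xy; apply: contrapT => Vy; apply: nb.
have [W nW Wx] := nbh_grow nV Vx xy Vy.
by exists W => // z /Wx; apply: comp_sub.
Qed.

(** * Connectedness of the grid and straight segments *)

Lemma int_steps (Q : int -> Prop) (i : int) :
  Q i -> (forall j, Q j -> Q (j + 1) /\ Q (j - 1)) -> forall k, Q k.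
Proof.
move=> Qi QS k.
have Hp n : Q (i + n%:Z).
  elim: n => [|n IH]; first by rewrite addr0.
  by have [+ _] := QS _ IH; rewrite -addrA -[1]/(1%N%:Z) -PoszD addn1.
have Hm n : Q (i - n%:Z).
  elim: n => [|n IH]; first by rewrite subr0.
  by have [_ ] := QS _ IH; congr Q; lia.
have [ik|ki] := leP i k.
  by have := Hp `|k - i|%N; congr Q; lia.
by have := Hm `|k - i|%N; congr Q; lia.
Qed.

Lemma nbr_closed_setT V x y : V x -> (forall p q, V p -> r p q -> V q) -> V y.
Proof.
move=> + VT; case: x y => [i j] [k l] Vij.
suff Vk : V (k, j).
  apply: (@int_steps (fun l => V (k, l)) j) => // l' Vl.
  have [h1 h2] := neighbor_vertical hr k l'.
  by split; [exact: VT h1|exact: VT h2].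
apply: (@int_steps (fun k => V (k, j)) i) => // k' Vl.
have [h1 h2] := neighbor_horizontal hr k' j.
by split; [exact: VT h1|exact: VT h2].
Qed.

Definition axis : set Z2 :=
  [set e | [\/ e = (1, 0), e = (-1, 0), e = (0, 1) | e = (0, -1)]].

Lemma axis_step x e : axis e -> r x (x + e).
Proof.
case: x => i j; have E a b : (i, j) + (a, b) = (i + a, j + b) :> Z2 by [].
have [h1 h2] := neighbor_horizontal hr i j.
by have [v1 v2] := neighbor_vertical hr i j; case=> ->; rewrite E ?addr0.
Qed.

Lemma nbh_ray n x e : axis e ->
  nbh r n x [set y | exists2 i, (i <= n)%N & y = x + e *+ i].
Proof.
move=> ae; have e0 : e != 0 by case: ae => ->.
elim: n => [|n IH].
  have -> : [set y | exists2 i, (i <= 0)%N & y = x + e *+ i] = [set x].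
    apply/seteqP; split=> y /=.
      by case=> i; rewrite leqn0 => /eqP -> ->; rewrite addr0.
    by move=> ->; exists 0%N; rewrite ?addr0.
  exact: nbh0.
have -> : [set y | exists2 i, (i <= n.+1)%N & y = x + e *+ i] =
    [set y | exists2 i, (i <= n)%N & y = x + e *+ i] `|` [set x + e *+ n.+1].
  apply/seteqP; split=> y /=.
    case=> i; rewrite leq_eqVlt => /orP[/eqP -> ->|]; first by right.
    by rewrite ltnS => ? ?; left; exists i.
  by case=> [[i /leqW]|->]; [exists i|exists n.+1].
apply: (nbhS IH (p := x + e *+ n)); first by exists n.
  by rewrite mulrSr addrA; apply: axis_step.
case=> i ni /addrI.
have inj : forall k l : nat, e *+ k = e *+ l -> k = l.
  by case: ae => -> k l; rewrite !pairMnE; case=> /=; rewrite ?mulNrn ?mul0rn ?natz; lia.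
by move=> /inj; lia.
Qed.

Lemma big_setT n x : big n setT x.
Proof.
have ae : axis (1, 0) by constructor 1.
by eexists; [exact: (nbh_ray n x ae)|].
Qed.

(** Without such an edge the component is closed under [r], hence equal to the grid, which contains
    segments of every size. *)
Lemma comp_boundary n S x : ~ big n S x -> S x ->
  exists p q, [/\ comp S x p, r p q & ~ S q].
Proof.
move=> nb Sx; apply: contrapT => nob; apply: nb.
suff -> : S = setT by apply: big_setT.
apply/seteqP; split=> // y _; apply: (comp_sub Sx).
apply: (@nbr_closed_setT _ x); first exact: compxx.
move=> p q xp pq.
apply: contrapT => xq; apply: nob; exists p, q; split=> // Sq.
by apply: xq; apply: comp_step pq Sq.
Qed.

End Components.

Arguments compxx {r S x}.
#[local] Hint Resolve compxx : core.

(** * Superlevel sets and the action of [L] *)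

Section Levels.
Variables (R : realType) (r : rel Z2) (hr : neighbor_relation r).
Implicit Types (f g h : Z2 -> R) (s t : R) (V A B : set Z2).
Implicit Types (p q x y z : Z2) (m n : nat).

Definition up g s : set Z2 := [set y | s < g y].

Lemma fun_oppK g : (\- (\- g)) = g.
Proof. by apply/funext => x /=; rewrite opprK. Qed.

(** Since [inf] is minus the [sup] of the opposites, this duality needs no bounds and reduces facts
    about [U] to facts about [L]. *)
Lemma U_opp n g : U r n g = \- L r n (\- g).
Proof.
apply/funext => x; rewrite /U /L /inf /= image_comp; congr (- sup _).
apply: eq_imagel => V _ /=; rewrite image_comp; congr (- sup _).
by apply: eq_imagel => y _ /=; rewrite opprK.
Qed.

Lemma finite_argmin V g : finite_set V -> V !=set0 ->
  exists2 y, V y & forall z, V z -> g y <= g z.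
Proof.
move=> /finite_seqP[s ->] [x xs].
suff [y ys ym] : exists2 y, y \in s & {in s, forall z, g y <= g z} by exists y.
elim: s x xs => // a s IH x _.
case: s IH => [_|b s IH].
  by exists a => [|z]; rewrite ?inE // => /eqP ->.
have [y ys ym] := IH b (mem_head _ _).
have [ay|ya] := leP (g a) (g y).
  exists a => [|z]; first exact: mem_head.
  by rewrite inE => /orP[/eqP ->//|/ym]; apply: le_trans.
exists y => [|z]; first by rewrite inE ys orbT.
by rewrite inE => /orP[/eqP ->|/ym//]; apply: ltW.
Qed.

Lemma inf_gtP n x V g s : nbh r n x V -> s < inf (g @` V) <-> V `<=` up g s.
Proof.
move=> nV; have V0 : V !=set0 by exists x; apply: nbhx nV.
have [y Vy ym] := finite_argmin g (nbh_finite nV) V0.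
have gy : lbound (g @` V) (g y) by move=> _ [z Vz <-]; apply: ym.
split=> [sV z Vz|Vs].
  by apply: (lt_le_trans sV); apply: ge_inf; [exists (g y)|exists z].
apply: lt_le_trans (Vs _ Vy) _.
by apply: lb_le_inf => //; exists (g y), y.
Qed.

(** The values under the [sup] are nonempty because the grid itself is big, and bounded by [g x]
    because every neighborhood contains [x]. *)
Lemma L_gtP n g x s : s < L r n g x <-> big r n (up g s) x.
Proof.
rewrite /L; set E := (X in sup X); split.
  move/sup_gt => [|_ [V nV <-] sV].
    have [V nV _] := big_setT hr n x.
    by exists (inf (g @` V)), V.
  by exists V => //; apply/(inf_gtP g s nV).
case=> V nV /(inf_gtP g s nV) sV; apply: (lt_le_trans sV).
apply: ub_le_sup; last by exists V.
exists (g x) => _ [W nW <-]; rewrite leNgt; apply/negP => /(inf_gtP g (g x) nW).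
by move=> /(_ _ (nbhx nW)); rewrite /up /= ltxx.
Qed.

Lemma L_le n g x : L r n g x <= g x.
Proof.
by rewrite leNgt; apply/negP => /L_gtP/big_in; rewrite /up /= ltxx.
Qed.

(* By [L_gtP], this says that [L n] fixes [g]. *)
Definition good n g := forall x s, s < g x -> big r n (up g s) x.

Lemma good0 g : good 0 g.
Proof. by move=> x s sx; exists [set x]; [exact: nbh0|move=> ? ->]. Qed.

Lemma good_L n g : good n (L r n g).
Proof.
move=> x s /L_gtP[V nV Vs]; exists V => // y Vy.
by apply/L_gtP; exists V => //; apply: nbh_mem nV Vy.
Qed.

Lemma comp_L_le n g x y : L r n g x < g x ->
  comp r (up g (L r n g x)) x y -> L r n g y <= L r n g x.
Proof.
move=> tx xy; rewrite leNgt; apply/negP => /L_gtP /(big_comp hr xy tx)/L_gtP.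
by rewrite ltxx.
Qed.

(** [L] creates no new pits. Where it lowers [g], the component of the removed peak lies in [T] and
    touches a point [z] outside the peak, with [g z] at most the new value; [T] is big at [z] by
    hypothesis, hence at [x]. *)
Lemma good_opp_L m n g : good m (\- g) -> good m (\- L r n g).
Proof.
move=> gm x s /= sx; set T := up (\- L r n g) s.
have gT : up (\- g) s `<=` T.
  move=> y; rewrite /T /up /= => /lt_le_trans; apply; rewrite lerN2; exact: L_le.
have [gs|gs] := ltP s (- g x); first exact: big_sub gT (gm x s gs).
have tg : L r n g x < g x by rewrite -ltrN2; apply: le_lt_trans gs sx.
have nbg : ~ big r n (up g (L r n g x)) x by move=> /L_gtP; rewrite ltxx.
have [p [z [xp pz zt]]] := comp_boundary hr nbg tg.
have CT : comp r (up g (L r n g x)) x `<=` T.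
  move=> y /(comp_L_le tg) yx; apply: (lt_le_trans sx).
  by rewrite lerN2.
have sz : s < (\- g) z.
  by apply: (lt_le_trans sx); rewrite lerN2 leNgt; apply/negP.
have bz := big_sub gT (gm z s sz).
apply: (@big_comp _ hr m T x z) => //.
apply: comp_step pz (gT _ sz).
have CC := @connected_comp _ hr (up g (L r n g x)) x tg.
exact: (connected_sub_comp hr CC CT compxx xp).
Qed.

(** A threshold below the common value of [g] puts all of [V] in one component, so bigness holds at
    all points of [V] or at none. *)
Lemma L_const n g V : connected_set r V ->
  (forall x y, V x -> V y -> g x = g y) ->
  forall x y, V x -> V y -> L r n g x = L r n g y.
Proof.
move=> VC gV.
suff H x y : V x -> V y -> L r n g x <= L r n g y.
  by move=> x y Vx Vy; apply/eqP; rewrite eq_le !H.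
move=> Vx Vy; rewrite leNgt; apply/negP => xy.
have sx := lt_le_trans xy (L_le n g x).
move: xy => /L_gtP /(big_connected hr VC _ Vy Vx) H.
suff /L_gtP : big r n (up g (L r n g y)) y by rewrite ltxx.
by apply: H => z Vz; rewrite /up /= (gV z x Vz Vx).
Qed.

Lemma L_peak m g x : good m g -> L r m.+1 g x < g x ->
  let A := comp r (up g (L r m.+1 g x)) x in
  [/\ nbh r m x A,
      forall y, A y -> g y = g x,
      forall y, A y -> L r m.+1 g y = L r m.+1 g x &
      forall p z, A p -> r p z -> ~ A z ->
        g z <= L r m.+1 g x /\ L r m.+1 g z = g z].
Proof.
set t := L r m.+1 g x => gm tx A.
have nbt : ~ big r m.+1 (up g t) x by move=> /L_gtP; rewrite ltxx.
have nA : nbh r m x A by apply: nbh_comp_exact => //; apply: gm.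
have At y : A y -> t < g y by apply: comp_sub tx _.
have AC := nbh_connected nA.
split=> // [y Ay|y Ay|p z Ap pz Az].
(* A neighborhood of [y2] above the level [g y1] would lie in [A] and have its cardinality, hence
   equal [A] and contain [y1]. *)
- suff H y1 y2 : A y1 -> A y2 -> g y2 <= g y1.
    by apply/eqP; rewrite eq_le !H // /A.
  move=> Ay1 Ay2; rewrite leNgt; apply/negP => lt12.
  have [V nV Vg] := gm _ _ lt12.
  have VA : V `<=` A.
    move=> z Vz; apply: (comp_trans Ay2).
    apply: (connected_sub_comp hr (nbh_connected nV) _ (nbhx nV)) Vz => w /Vg.
    by apply: lt_trans; apply: At.
  have VE := nbh_eq nV nA VA.
  by move: Ay1; rewrite -VE => /Vg; rewrite /up /= ltxx.
- apply/eqP; rewrite eq_le comp_L_le //= leNgt; apply/negP => yt.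
  have ys : big r m.+1 (up g (L r m.+1 g y)) x by apply/L_gtP.
  suff /L_gtP : big r m.+1 (up g (L r m.+1 g y)) y by rewrite ltxx.
  apply: (big_connected hr AC _ Ay _ ys) => // z /At.
  exact: lt_trans.
- have zt : g z <= t.
    by rewrite leNgt; apply/negP => tz; apply: Az; apply: comp_step Ap pz tz.
  split=> //; apply/eqP; rewrite eq_le L_le /= leNgt; apply/negP => zz.
  suff /L_gtP : big r m.+1 (up g (L r m.+1 g z)) z by rewrite ltxx.
  (* [A] with [z] added has the m + 2 points that [L r m.+1] requires, and [g] exceeds the supposed
     smaller value on all of them. *)
  have nAz := nbhS hr (nbh_mem nA Ap) Ap pz Az.
  exists (A `|` [set z]); first by apply: nbh_mem nAz _; right.
  move=> w [/At tw|->//]; rewrite /up /=.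
  exact: lt_trans zz (le_lt_trans zt tw).
Qed.

End Levels.

(** * Duality for [U], one smoothing level, and its iteration *)

Section Smoother.
Variables (R : realType) (r : rel Z2) (hr : neighbor_relation r).
Implicit Types (f g h : Z2 -> R) (s t : R) (V A B : set Z2).
Implicit Types (p q x y z : Z2) (m n : nat).

Lemma L_opp n g : L r n (\- g) = \- U r n g.
Proof. by rewrite U_opp fun_oppK. Qed.

Lemma U_ge n g x : g x <= U r n g x.
Proof. by rewrite U_opp /= lerNr; apply: (L_le hr n (\- g)). Qed.

Lemma U_const n g V : connected_set r V ->
  (forall x y, V x -> V y -> g x = g y) ->
  forall x y, V x -> V y -> U r n g x = U r n g y.
Proof.
move=> VC gV x y Vx Vy; rewrite U_opp /=; congr (- _).
by apply: (L_const hr n VC) Vx Vy => x' y' /gV + /[dup] => /[apply] + _ /=; move=> ->.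
Qed.

Lemma U_peak m h x : good r m (\- h) -> h x < U r m.+1 h x ->
  let B := comp r [set y | h y < U r m.+1 h x] x in
  [/\ nbh r m x B,
      forall y, B y -> h y = h x,
      forall y, B y -> U r m.+1 h y = U r m.+1 h x &
      forall p z, B p -> r p z -> ~ B z ->
        U r m.+1 h x <= h z /\ U r m.+1 h z = h z].
Proof.
move=> hm hx B.
have Lh : L r m.+1 (\- h) x < (\- h) x by rewrite L_opp /= ltrN2.
have := L_peak hr hm Lh; rewrite L_opp /=.
have -> : up (\- h) (- U r m.+1 h x) = [set y | h y < U r m.+1 h x].
  by apply/seteqP; split=> y; rewrite /up /= ltrN2.
case=> nB hB UB bB; split=> // [y /hB /oppr_inj//|y /UB /oppr_inj//|].
by move=> p z Bp pz /(bB _ _ Bp pz)[]; rewrite lerN2 => ? /oppr_inj.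
Qed.

Lemma LU_disjoint m g x : good r m g -> good r m (\- g) ->
  L r m.+1 g x < g x -> U r m.+1 (L r m.+1 g) x = L r m.+1 g x.
Proof.
move=> gm ogm; set h := L r m.+1 g => hx.
apply/eqP; rewrite eq_le U_ge andbT leNgt; apply/negP => xk.
have [nA _ hA bA] := L_peak hr gm hx.
have [nB _ _ bB] := U_peak (good_opp_L hr ogm) xk.
set A := comp r _ x in nA hA bA; set B := comp r _ x in nB bB.
have AB : A = B.
  apply: (nbh_eq nA nB).
  apply: (connected_sub_comp hr (nbh_connected nA) _ (nbhx nA)) => y Ay /=.
  by rewrite -/h in hA *; rewrite hA.
have nbig : ~ big r m.+1 (up g (h x)) x.
  by move=> /(L_gtP hr); rewrite ltxx.
(* The point [z] borders both sets, which gives the contradictory chain h z <= g z <= h x < U h x <=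
   h z. *)
have [p [z [Ap pz hz]]] := comp_boundary hr nbig hx.
have nAz : ~ A z by move=> Az; apply: hz; apply: comp_sub Az.
have [zx _] := bA _ _ Ap pz nAz.
have [kz _] : U r m.+1 h x <= h z /\ U r m.+1 h z = h z.
  by apply: (bB p) => //; rewrite -/B -AB.
have := lt_le_trans xk (le_trans kz (le_trans (L_le hr m.+1 g z) zx)).
by rewrite ltxx.
Qed.

Definition diff n g x := g x - U r n (L r n g) x.

(** The component is identified with the peak of [g] or the pit of [h] at [x]: [diff] is constant
    there and takes another value at every adjacent outside point. *)
Lemma level_component m g x : good r m g -> good r m (\- g) ->
  diff m.+1 g x != 0 ->
  let V := comp r [set y | diff m.+1 g y = diff m.+1 g x] x in
  nbh r m x V /\
  (forall y, V y -> U r m.+1 (L r m.+1 g) y = U r m.+1 (L r m.+1 g) x).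
Proof.
move=> gm ogm dx V.
set h := L r m.+1 g; set k := U r m.+1 h.
have dE y : diff m.+1 g y = g y - k y by [].
have hk y : h y <= k y by apply: U_ge.
have hg y : h y <= g y by apply: L_le.
have khE y : h y < g y -> k y = h y by apply: LU_disjoint.
have sgn y : [\/ h y < g y /\ k y = h y, h y < k y /\ g y = h y |
               g y = h y /\ k y = h y].
  have [hy|] := ltP (h y) (g y); first by constructor 1; split=> //; apply: khE.
  move=> gh; have {}gh : g y = h y by apply/eqP; rewrite eq_le gh hg.
  have [hy|kh] := ltP (h y) (k y); first by constructor 2.
  by constructor 3; split=> //; apply/eqP; rewrite eq_le kh hk.
suff [C [nC dC kC bC]] : exists C, [/\ nbh r m x C,
    forall y, C y -> diff m.+1 g y = diff m.+1 g x,
    forall y, C y -> k y = k x &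
    forall p z, C p -> r p z -> ~ C z -> diff m.+1 g z <> diff m.+1 g x].
  suff -> : V = C by [].
  apply/seteqP; split=> y.
    elim=> [|p q _ Cp pq dq]; first exact: nbhx nC.
    by apply: contrapT => /(bC _ _ Cp pq).
  exact: (connected_sub_comp hr (nbh_connected nC) _ (nbhx nC)).
case: (sgn x) => [[hx kx]|[hx gx]|[gx kx]].
- have [nA gA hA bA] := L_peak hr gm hx.
  exists (comp r (up g (h x)) x).
  have kA y : comp r (up g (h x)) x y -> k y = k x.
    move=> Ay; rewrite kx khE; first exact: hA.
    by rewrite [h y]hA // gA.
  split=> // [y Ay|p z Ap pz Az]; first by rewrite !dE kA // gA.
  (* Here [diff] is positive at [x], but nonpositive at [z], where [L] changes nothing. The pit case
     below has the opposite signs. *)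
  have [_ hz] := bA _ _ Ap pz Az.
  rewrite !dE => dd; have := hk z; rewrite /h hz; lra.
- have [nB hB kB bB] := U_peak (good_opp_L hr ogm) hx.
  exists (comp r [set y | h y < k x] x); split=> // [y By|p z Bp pz Bz].
    (* On the pit h y = h x < k x = k y, which leaves only the second alternative of [sgn]. *)
    have gy : g y = h y.
      by case: (sgn y) => [[_]|[_]|[]] // ky; have := hB y By; have := kB y By;
        rewrite -/h -/k; lra.
    by rewrite !dE gy gx [k y]kB // [h y]hB.
  have [_ kz] := bB _ _ Bp pz Bz.
  by rewrite !dE => dd; have := hg z; move: kz; rewrite -/h -/k; lra.
- by move: dx; rewrite dE gx kx subrr eqxx.
Qed.

Lemma F_S n f : F r n.+1 f = U r n.+1 (L r n.+1 (F r n f)).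
Proof. by []. Qed.

(** By duality the last [U] is an [L] on opposites: [good_L] gives the second half, and [good_opp_L]
    carries the first, created by the last [L], through it. *)
Lemma good_F n f : good r n (F r n f) /\ good r n (\- F r n f).
Proof.
elim: n => [|n [_ IH]]; first by split; apply: good0.
rewrite F_S U_opp fun_oppK; split; last exact: good_L.
by apply: good_opp_L => //; rewrite fun_oppK; apply: good_L.
Qed.

Lemma F_const n m f V : (n <= m)%N -> connected_set r V ->
  (forall x y, V x -> V y -> F r n f x = F r n f y) ->
  forall x y, V x -> V y -> F r m f x = F r m f y.
Proof.
move=> nm VC FV; elim: m nm => [|m IH]; first by rewrite leqn0 => /eqP <-.
rewrite leq_eqVlt => /orP[/eqP <- //|/IH{}IH].
by rewrite F_S; apply: U_const => //; apply: L_const.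
Qed.

(* The complement of a box is a union of rays parallel to the axes; their
   initial segments show that zeros outside the box stay zeros. *)
Definition out (M : nat) : set Z2 :=
  [set x | (M%:Z < `|x.1|) \/ (M%:Z < `|x.2|)].

Lemma out_ray M x : out M x ->
  exists2 e, axis e & forall i, out M (x + e *+ i).
Proof.
case: x => a b.
have E u v i : (a, b) + (u, v) *+ i = (a + u *+ i, b + v *+ i) :> Z2.
  by rewrite pairMnE.
case=> /= hx; [have [x0|x0] := leP 0 a|have [x0|x0] := leP 0 b].
- exists (1, 0); first by constructor 1.
  by move=> i; rewrite E; left; rewrite /= natz; lia.
- exists (-1, 0); first by constructor 2.
  by move=> i; rewrite E; left; rewrite /= mulNrn natz; lia.
- exists (0, 1); first by constructor 3.
  by move=> i; rewrite E; right; rewrite /= natz; lia.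
- exists (0, -1); first by constructor 4.
  by move=> i; rewrite E; right; rewrite /= mulNrn natz; lia.
Qed.

Lemma L_out M n g : (forall x, out M x -> g x = 0) ->
  forall x, out M x -> L r n g x = 0.
Proof.
move=> g0 x ox; apply/eqP; rewrite eq_le -{1}(g0 _ ox) L_le //= leNgt.
apply/negP => L0; have [e ae oe] := out_ray ox.
suff /(L_gtP hr) : big r n (up g (L r n g x)) x by rewrite ltxx.
eexists; first exact: (nbh_ray hr n x ae).
by move=> _ [i _ ->]; rewrite /up /= (g0 _ (oe i)).
Qed.

Lemma F_out M n f : (forall x, out M x -> f x = 0) ->
  forall x, out M x -> F r n f x = 0.
Proof.
move=> f0; elim: n => // n IH x ox; rewrite F_S U_opp /=.
rewrite (@L_out M) ?oppr0 // => y oy /=.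
by rewrite (@L_out M) ?oppr0.
Qed.

Lemma finite_box M : finite_set (~` out M).
Proof.
pose c (i : nat) : int := i%:Z - M%:Z.
have : finite_set [set (c u.1, c u.2) | u in `I_(M + M).+1 `*` `I_(M + M).+1].
  by apply/finite_image/finite_setX; apply: finite_II.
apply: sub_finite_set => -[i j] /not_orP[/= /negP + /negP].
rewrite -!leNgt => hi hj; exists (`|(i + M%:Z)%R|%N, `|(j + M%:Z)%R|%N); rewrite /c /=.
  by split=> /=; lia.
by congr (_, _); lia.
Qed.

Lemma finite_nonzero_diff n f : finite_set (nonzero_set f) ->
  finite_set (nonzero_set (diff n.+1 (F r n f))).
Proof.
move=> /finite_seqP[s fs].
(* The square of radius [M] contains every nonzero point of [f]. *)
pose M := \max_(p <- s) maxn `|p.1| `|p.2|.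
have f0 x : out M x -> f x = 0.
  move=> ox; apply/eqP/negPn/negP => fx.
  have xs : x \in s by have : nonzero_set f x by []; rewrite fs.
  have : (maxn `|x.1| `|x.2| <= M)%N.
    exact: (leq_bigmax_seq (F := fun p : Z2 => maxn `|p.1| `|p.2|) _ xs).
  by case: x ox {fx xs} => a b [] /=; lia.
apply: sub_finite_set (finite_box M) => x /= /negP dx ox; apply: dx.
by rewrite /diff -F_S !(F_out _ f0) // subrr.
Qed.

End Smoother.

(** * Splitting a function into pulses on its level components *)

Section Decomposition.
Variables (R : realType) (r : rel Z2) (hr : neighbor_relation r).
Variable d : Z2 -> R.
Implicit Types (x y z : Z2) (s : nat).

Definition level x : set Z2 := comp r [set y | d y = d x] x.

Lemma level_val x y : level x y -> d y = d x.
Proof. exact: (@comp_sub r [set y | d y = d x] x erefl). Qed.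

Lemma level_connected x : connected_set r (level x).
Proof. exact: (@connected_comp r hr [set y | d y = d x] x erefl). Qed.

Lemma level_sym x y : level x y -> level y x.
Proof.
move=> xy; rewrite /level (level_val xy).
exact: (@comp_sym r hr [set y | d y = d x] x y erefl).
Qed.

Lemma level_trans x y z : level x y -> level y z -> level x z.
Proof.
by move=> xy; rewrite /level (level_val xy); apply: comp_trans.
Qed.

(** Taking the point of least code in each nonzero component gives the components distinct natural
    indices. *)
Definition rep x := d x != 0 /\ forall y, level x y -> (pickle x <= pickle y)%N.

Lemma repP y : d y != 0 -> exists2 x, rep x & level x y.
Proof.
move=> dy.
have : exists k : nat, `[< exists2 x, level y x & pickle x = k >].
  by exists (pickle y); apply/asboolP; exists y => //; exact: compxx.
case/ex_minnP => _ /asboolP[x yx <-] xmin.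
exists x; last exact: level_sym.
split=> [|z xz]; first by rewrite (level_val yx).
by apply: xmin; apply/asboolP; exists z => //; apply: level_trans xz.
Qed.

Lemma rep_eq x1 x2 y :
  rep x1 -> rep x2 -> level x1 y -> level x2 y -> x1 = x2.
Proof.
move=> [_ m1] [_ m2] h1 h2; apply: (pcan_inj pickleK).
have h12 := level_trans h1 (level_sym h2).
by apply/eqP; rewrite eqn_leq m1 // m2 //; apply: level_sym.
Qed.

(* Indices that do not come from a representative get the empty support, which
   avoids renumbering the components. *)
Definition piece s : set Z2 :=
  [set y | exists x, [/\ s = (pickle x).+1, rep x & level x y]].

Lemma pieceP s : piece s = set0 \/ exists2 x, d x != 0 & piece s = level x.
Proof.
have [[x [sx rx]]|nx] := pselect (exists x, s = (pickle x).+1 /\ rep x).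
  right; exists x; first by case: rx.
  apply/seteqP; split=> [y [x' []]|y xy]; last by exists x.
  by rewrite sx => -[/(pcan_inj pickleK) ->].
left; apply/seteqP; split=> // y [x [sx rx _]]; apply: nx.
by exists x.
Qed.

Lemma connected_piece s : connected_set r (piece s).
Proof. by case: (pieceP s) => [->//|[x _ ->]]; exact: level_connected. Qed.

Lemma piece_pulse s : exists alpha : R,
  (forall x, piece s x -> patch (fun=> 0) (piece s) d x = alpha) /\
  (forall x, ~ piece s x -> patch (fun=> 0) (piece s) d x = 0).
Proof.
have [p0|[x _ px]] := pieceP s.
  by exists 0; split=> x; rewrite p0 // /patch memNset.
exists (d x); split=> y; rewrite /patch; last by move=> ny; rewrite memNset.
by move=> py; rewrite mem_set //; apply: level_val; rewrite -px.
Qed.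

Definition piece_of s : pulse R r := Pulse (@connected_piece s) (piece_pulse s).

(** In the finite case the largest code of a nonzero point bounds all indices; the successor makes
    them start at 1. *)
Lemma upto_pickle : exists g : option nat,
  [/\ upto g 1%N,
      finite_set (nonzero_set d) -> exists m, g = Some m &
      forall x, d x != 0 -> upto g (pickle x).+1].
Proof.
have [/finite_seqP[s ds]|nf] := pselect (finite_set (nonzero_set d)); last first.
  by exists None; split.
exists (Some (\max_(x <- s) pickle x).+1); split=> // [_|x dx].
  by eexists.
split=> //; rewrite ltnS; apply: leq_bigmax_seq => //.
by have : nonzero_set d x by []; rewrite ds.
Qed.

Lemma pulse_decomposition : exists (g : option nat) (phi : nat -> pulse R r),
  [/\ upto g 1%N,
      finite_set (nonzero_set d) -> exists m, g = Some m,
      forall x, d x = \sum_(s \in upto g) phi s x,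
      forall s1 s2, s1 <> s2 -> supp (phi s1) `&` supp (phi s2) = set0 &
      forall s, supp (phi s) = set0 \/
        exists2 x, d x != 0 & supp (phi s) = level x].
Proof.
have [g [g1 gf gp]] := upto_pickle.
exists g, piece_of; split=> // [x|s1 s2 s12|]; last exact: pieceP.
- have [dx|dx] := eqVneq (d x) 0.
    by rewrite fsbig1 // => s _; rewrite /= /patch; case: ifP.
  have [y ry yx] := repP dx.
  (* Only the index of the representative [y] contributes at [x]: another piece containing [x] would
     have the same representative. *)
  rewrite -(@fsbig_widen _ _ _ _ [set (pickle y).+1]).
  + rewrite fsbig_set1 /= /patch mem_set //.
    by exists y.
  + by move=> _ ->; apply: gp; case: ry.
  + move=> s /= [_ sy]; rewrite /patch; case: ifPn => // /set_mem.
    case=> z [sz rz zx]; case: sy; rewrite sz.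
    by rewrite (rep_eq rz ry zx yx).
- apply/seteqP; split=> // x [[y [e1 ry yx]] [z [e2 rz zx]]].
  by apply: s12; rewrite e1 e2 (rep_eq ry rz yx zx).
Qed.

End Decomposition.

(* The supports in one level being disjoint, at most one term of the sum over
   [upto (gamma n)] is nonzero at each point x. *)
Theorem theorem17 (R : realType) (r : rel Z2) (hr : neighbor_relation r)
    (f : Z2 -> R) :
  exists (gamma : nat -> option nat) (phi : nat -> nat -> pulse R r),
    (forall n : nat, (1 <= n)%N ->
      [/\ upto (gamma n) 1%N,
          (finite_set (nonzero_set f) \/
           finite_set (nonzero_set ((idB (U r n \o L r n) \o F r n.-1) f)) ->
           exists m : nat, gamma n = Some m),
          (forall x : Z2, (idB (U r n \o L r n) \o F r n.-1) f x =
             \sum_(s \in upto (gamma n)) phi n s x)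
        & forall s1 s2 : nat, upto (gamma n) s1 -> upto (gamma n) s2 ->
            s1 <> s2 -> supp (phi n s1) `&` supp (phi n s2) = set0]) /\
    (forall n1 n2 s1 s2 : nat, (1 <= n1)%N -> (n1 < n2)%N ->
       upto (gamma n1) s1 -> upto (gamma n2) s2 ->
       supp (phi n1 s1) `&` supp (phi n2 s2) !=set0 ->
       supp (phi n1 s1) `<` supp (phi n2 s2)).
Proof.
pose d n := diff r n (F r n.-1 f).
have [gamma /choice[phi phiP]] := choice (fun n => pulse_decomposition hr (d n)).
have component m x : d m.+1 x != 0 -> nbh r m x (level r (d m.+1) x) /\
    forall y, level r (d m.+1) x y -> F r m.+1 f y = F r m.+1 f x.
  by have [gm ogm] := good_F hr m f; apply: level_component.
exists gamma, phi; split=> [[//|n] _|].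
  have [g1 gfin dsum disj _] := phiP n.+1.
  split=> // [[/(finite_nonzero_diff hr n)|]|s1 s2 _ _]; [exact: gfin..|].
  exact: disj.
move=> [//|m1] [//|m2] s1 s2 _; rewrite ltnS => m12 _ _ [z].
(* The common point [z] excludes empty supports, so both are level components of nonzero value. *)
have [_ _ _ _ /(_ s1)[->[]//|[x1 dx1 ->]]] := phiP m1.+1.
have [_ _ _ _ /(_ s2)[->[]//|[x2 dx2 ->]]] := phiP m2.+1.
case=> z1 z2.
have [nV VF] := component _ _ dx1; have [nW _] := component _ _ dx2.
set V := level _ _ _ in nV VF z1 *; set W := level _ _ _ in nW z2 *.
have VC := nbh_connected nV.
have gV : forall x y, V x -> V y -> F r m2 f x = F r m2 f y.
  by apply: (F_const hr m12 VC) => x y /VF -> /VF ->.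
(* The later difference is constant on [V], and [z] in [W] fixes its value. *)
have dV x : V x -> d m2.+1 x = d m2.+1 x2.
  move=> Vx; rewrite -(level_val z2) /d /diff /= (gV x z) //; congr (_ - _).
  by apply: (U_const hr _ VC) => //; apply: (L_const hr _ VC).
split=> [x Vx|WV].
  apply: comp_trans z2 _.
  exact: (connected_sub_comp hr VC dV z1).
(* Strictness: [W] has m2 + 1 points and [V] only m1 + 1. *)
have := subset_card_le WV.
rewrite (card_le_eql (nbh_card nW)) (card_le_eqr (nbh_card nV)) card_le_II.
by rewrite ltnS leqNgt m12.
Qed.
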